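(* A 1-mecw functor $F:\mathbf{Comp}\to\mathbf{Comp}$ is skeletal if it is finitely bicommutative and finitely skeletal.
   Context: All spaces are Hausdorff and all maps are continuous. $\mathbf{Comp}$ is the category of compact Hausdorff spaces (compacta) and continuous maps. A map $f:X\to Y$ between topological spaces is skeletal if for each nowhere dense subset $A\subset Y$ the preimage $f^{-1}(A)$ is nowhere dense in $X$. A functor $F:\mathbf{Comp}\to\mathbf{Comp}$ is: monomorphic (resp. epimorphic) if $Ff$ is injective (resp. surjective) for every injective (resp. surjective) map $f$ between compacta; continuous if it preserves limits of inverse spectra of compacta, i.e. for each inverse spectrum $\mathcal S$ of compacta over a directed set the natural map $F(\lim\mathcal S)\to\lim F\mathcal S$ is a homeomorphism; skeletal (resp. finitely skeletal) if for any open surjection $f:X\to Y$ between compacta (resp. finite compacta) the map $Ff:FX\to FY$ is skeletal; weight-preserving if $w(FX)\le w(X)$ for each infinite compactum $X$, where $w$ denotes the weight. A commutative square of continuous maps between compacta, with maps $\tilde f:\tilde X\to\tilde Y$, $p_X:\tilde X\to X$, $p_Y:\tilde Y\to Y$, $f:X\to Y$ and $p_Y\circ\tilde f=f\circ p_X$, is bicommutative if $\tilde f(p_X^{-1}(x))=p_Y^{-1}(f(x))$ for all $x\in X$. $F$ is finitely bicommutative if it preserves the bicommutativity of such squares in which $f,\tilde f,p_X,p_Y$ are surjective and $X,Y,\tilde X,\tilde Y$ are finite. $F$ preserves finite 1-preimages if it preserves the bicommutativity of such squares in which $f,\tilde f$ are injective, $p_X$ is bijective and $X$ is finite. A 1-mecw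 functor is a monomorphic, epimorphic, continuous, weight-preserving functor that preserves finite 1-preimages. *)

(* Defs.v *)
From HB Require Import structures.
From mathcomp Require Import all_boot.
From mathcomp Require Import all_classical.
From mathcomp Require Import topology.

Set Implicit Arguments.
Unset Strict Implicit.
Unset Printing Implicit Defensive.

Local Open Scope classical_set_scope.
Local Open Scope card_scope.

(* A topologicalType may be empty, so the empty space is a compactum. *)
Record compactum := Compactum {
  compactum_space :> topologicalType;
  compactum_compact : compact [set: compactum_space];
  compactum_hausdorff : hausdorff_space compactum_space }.

Arguments compactum_compact : clear implicits.
Arguments compactum_hausdorff : clear implicits.

Definition finite_space (X : Type) := finite_set [set: X].

Definition surjective (X Y : Type) (f : X -> Y) := set_surj [set: X] [set: Y] f.

Definition open_map (X Y : topologicalType) (f : X -> Y) :=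
  forall U : set X, open U -> open (f @` U).

Definition homeomorphism (X Y : topologicalType) (f : X -> Y) :=
  continuous f /\
  exists g : Y -> X, [/\ cancel f g, cancel g f & continuous g].

Definition nowhere_dense (X : topologicalType) (A : set X) :=
  interior (closure A) = set0.

Definition skeletal_map (X Y : topologicalType) (f : X -> Y) :=
  forall A : set Y, nowhere_dense A -> nowhere_dense (f @^-1` A).

(* The weight of X is the cardinality of any base satisfying [weight_base];
   such a base exists because cardinals are well-ordered. *)
Definition weight_base (X : topologicalType) (B : set (set X)) :=
  basis B /\ forall B' : set (set X), basis B' -> B #<= B'.

Definition weight_le (X Y : topologicalType) :=
  exists (A : set (set X)) (B : set (set Y)),
    [/\ weight_base A, weight_base B & A #<= B].

Record directed_set := DirectedSet {
  ds_carrier :> Type;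
  ds_le : ds_carrier -> ds_carrier -> Prop;
  ds_inhabited : inhabited ds_carrier;
  ds_refl : forall i, ds_le i i;
  ds_trans : forall i j k, ds_le i j -> ds_le j k -> ds_le i k;
  ds_directed : forall i j, exists k, ds_le i k /\ ds_le j k }.

Record inverse_spectrum (I : directed_set) := InverseSpectrum {
  spec_obj :> I -> compactum;
  spec_map : forall i j : I, ds_le i j ->
    continuousType (spec_obj j) (spec_obj i);
  spec_id : forall (i : I) (le_ii : ds_le i i), spec_map le_ii =1 id;
  spec_comp : forall (i j k : I)
    (le_ij : ds_le i j) (le_jk : ds_le j k) (le_ik : ds_le i k),
    spec_map le_ij \o spec_map le_jk =1 spec_map le_ik }.

Section Limit.
Variables (I : directed_set) (S : inverse_spectrum I).

Definition threads : set (prod_topology (fun i : I => S i)) :=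
  [set x | forall (i j : I) (le_ij : ds_le i j),
             spec_map S le_ij (x j) = x i].

Lemma spec_proj_continuous (i : I) :
  continuous (fun x : prod_topology (fun i : I => S i) => x i).
Proof. exact: (@proj_continuous {classic I} (fun i : I => S i)). Qed.

Lemma spec_prod_compact : compact [set: prod_topology (fun i : I => S i)].
Proof.
have := @tychonoff {classic I} (fun i : I => S i) (fun i => [set: S i])
  (fun i => compactum_compact (S i)).
by congr (compact _); apply/seteqP; split.
Qed.

Lemma spec_prod_hausdorff :
  hausdorff_space (prod_topology (fun i : I => S i)).
Proof.
exact: (@hausdorff_product {classic I} (fun i : I => S i)
  (fun i => @compactum_hausdorff (S i))).
Qed.

Lemma threads_closed : closed threads.
Proof.
move=> x clx i j le_ij; apply: (compactum_hausdorff (S i)) => U V nU nV.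
have cj : {for x, continuous (fun y : prod_topology (fun i : I => S i) =>
    spec_map S le_ij (y j))}.
  apply: continuous_comp; first exact: spec_proj_continuous.
  exact: cts_fun.
have nx : nbhs x ([set y | U (spec_map S le_ij (y j))] `&` [set y | V (y i)]).
  by apply: filterI; [exact: cj nU | exact: spec_proj_continuous nV].
have [y [Ty [Uy Vy]]] := clx _ nx.
by exists (y i); split => //; rewrite -(Ty _ _ le_ij).
Qed.

Lemma threads_val_continuous :
  continuous (set_val : set_type threads -> prod_topology (fun i : I => S i)).
Proof. exact: initial_continuous. Qed.

Lemma limit_compact : compact [set: set_type threads].
Proof.
have cT : compact threads.
  by apply: (subclosed_compact threads_closed spec_prod_compact).
move=> F PF _.
have FT : F (set_val @^-1` threads).
  by apply: (filterS _ (@filterT _ F _)) => x _; exact: set_valP.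
have [p [Tp clp]] := cT (set_val @ F) (fmap_proper_filter _ PF) FT.
exists (exist _ p (mem_set Tp)); split => // A B FA [_ [[W oW <-] /= Wp WB]].
have FW : F (set_val @^-1` (set_val @` A)).
  by apply: filterS FA => x Ax; exists x.
have [_ [[x Ax <-] Wx]] := clp _ W FW (open_nbhs_nbhs (conj oW Wp)).
by exists x; split => //; exact: WB.
Qed.

Lemma limit_hausdorff : hausdorff_space (set_type threads).
Proof.
move=> x y clxy; apply: val_inj; apply: spec_prod_hausdorff => A B nA nB.
have [z [Az Bz]] := clxy _ _ (threads_val_continuous nA) (threads_val_continuous nB).
by exists (set_val z).
Qed.

Definition limit : compactum := Compactum limit_compact limit_hausdorff.

Definition limit_proj_fun (i : I) (x : limit) : S i := set_val x i.

Lemma limit_proj_continuous (i : I) : continuous (@limit_proj_fun i).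
Proof.
by move=> x U nU; exact: threads_val_continuous (spec_proj_continuous nU).
Qed.

Definition limit_proj (i : I) : continuousType limit (S i) :=
  mkcts (@limit_proj_continuous i).

Lemma limit_projE (i j : I) (le_ij : ds_le i j) :
  spec_map S le_ij \o limit_proj j =1 limit_proj i.
Proof. by move=> x; exact: (set_valP x). Qed.

End Limit.

Arguments threads {I} S _.

Record comp_functor := CompFunctor {
  fobj :> compactum -> compactum;
  fmap : forall X Y : compactum,
    continuousType X Y -> continuousType (fobj X) (fobj Y);
  fmap_id : forall X : compactum, fmap (idfun : continuousType X X) =1 id;
  fmap_comp : forall (X Y Z : compactum)
    (g : continuousType Y Z) (f : continuousType X Y),
    fmap (g \o f : continuousType X Z) =1 fmap g \o fmap f }.

Section FunctorSpectrum.
Variables (F : comp_functor) (I : directed_set) (S : inverse_spectrum I).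

Lemma fspec_id (i : I) (le_ii : ds_le i i) : fmap F (spec_map S le_ii) =1 id.
Proof.
have -> : spec_map S le_ii = (idfun : continuousType (S i) (S i)).
  by apply/continuousEP; exact: spec_id.
exact: fmap_id.
Qed.

Lemma fspec_comp (i j k : I)
    (le_ij : ds_le i j) (le_jk : ds_le j k) (le_ik : ds_le i k) :
  fmap F (spec_map S le_ij) \o fmap F (spec_map S le_jk)
    =1 fmap F (spec_map S le_ik).
Proof.
move=> x; rewrite -fmap_comp; congr (fmap F _ x).
by apply/continuousEP; exact: spec_comp.
Qed.

Definition fspec : inverse_spectrum I := InverseSpectrum fspec_id fspec_comp.

Lemma fproj_threads (y : F (limit S)) :
  threads fspec (fun i => fmap F (limit_proj S i) y).
Proof.
move=> i j le_ij /=.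
transitivity (fmap F (spec_map S le_ij \o limit_proj S j
                      : continuousType (limit S) (S i)) y).
  by rewrite fmap_comp.
by congr (fmap F _ y); apply/continuousEP; exact: limit_projE.
Qed.

Definition limit_comparison (y : F (limit S)) : limit fspec :=
  exist _ (fun i => fmap F (limit_proj S i) y) (mem_set (fproj_threads y)).

End FunctorSpectrum.

Definition bicommutative (tX tY X Y : compactum) (tf : continuousType tX tY)
    (pX : continuousType tX X) (pY : continuousType tY Y)
    (f : continuousType X Y) :=
  pY \o tf =1 f \o pX /\
  forall x : X, tf @` (pX @^-1` [set x]) = pY @^-1` [set f x].

Section Properties.
Variable F : comp_functor.

Definition monomorphic := forall (X Y : compactum) (f : continuousType X Y),
  injective f -> injective (fmap F f).

Definition epimorphic := forall (X Y : compactum) (f : continuousType X Y),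
  surjective f -> surjective (fmap F f).

Definition continuous_functor :=
  forall (I : directed_set) (S : inverse_spectrum I),
    homeomorphism (@limit_comparison F I S).

Definition weight_preserving := forall X : compactum,
  ~ finite_space X -> weight_le (F X) X.

Definition skeletal := forall (X Y : compactum) (f : continuousType X Y),
  open_map f -> surjective f -> skeletal_map (fmap F f).

Definition finitely_skeletal :=
  forall (X Y : compactum) (f : continuousType X Y),
    finite_space X -> finite_space Y ->
    open_map f -> surjective f -> skeletal_map (fmap F f).

Definition finitely_bicommutative :=
  forall (tX tY X Y : compactum) (tf : continuousType tX tY)
    (pX : continuousType tX X) (pY : continuousType tY Y)
    (f : continuousType X Y),
    finite_space X -> finite_space Y -> finite_space tX -> finite_space tY ->
    surjective f -> surjective tf -> surjective pX -> surjective pY ->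
    bicommutative tf pX pY f ->
    bicommutative (fmap F tf) (fmap F pX) (fmap F pY) (fmap F f).

Definition preserves_finite_1preimages :=
  forall (tX tY X Y : compactum) (tf : continuousType tX tY)
    (pX : continuousType tX X) (pY : continuousType tY Y)
    (f : continuousType X Y),
    finite_space X -> injective f -> injective tf -> bijective pX ->
    bicommutative tf pX pY f ->
    bicommutative (fmap F tf) (fmap F pX) (fmap F pY) (fmap F f).

Definition mecw1 :=
  [/\ monomorphic, epimorphic, continuous_functor, weight_preserving
    & preserves_finite_1preimages].

End Properties.

(* Main.v *)
(** Every compactum X is the image of the zero-dimensional space Gl(X) of maximal
    filters of open sets (its Gleason cover), and an open surjection f : X -> Y
    lifts to an open surjection Gl(X) -> Gl(Y). The latter is the limit of
    bicommutative squares over open surjections between finite spaces; applying F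
    and a compactness argument, every nonempty open U in F(Gl(X)) has an image that
    contains the preimage of a nonempty open W in F(N), for some finite partition
    Gl(Y) -> N. It remains to see that this preimage has an image with nonempty
    interior in F(Y). For this Gl(Y) is replaced by its image D in N * Y: the map
    D -> Y has a singleton fibre over a suitable point of each block of the
    partition, so by preservation of 1-preimages F(D) -> F(Y) has singleton fibres
    over the image of F(N). A closed surjection with a singleton fibre inside an
    open set covers a neighbourhood of the corresponding point. *)

From HB Require Import structures.
From mathcomp Require Import all_boot.
From mathcomp Require Import all_classical.
From mathcomp Require Import topology.
Require Import Defs.

Set Implicit Arguments.
Unset Strict Implicit.
Unset Printing Implicit Defensive.

Local Open Scope classical_set_scope.

(** * Compact spaces *)

Lemma surjectiveP (X Y : Type) (f : X -> Y) (y : Y) :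
  surjective f -> exists x, f x = y.
Proof. by move=> /(_ y I) [x _ <-]; exists x. Qed.

Lemma surjectiveI (X Y : Type) (f : X -> Y) :
  (forall y, exists x, f x = y) -> surjective f.
Proof. by move=> fs y _; have [x <-] := fs y; exists x. Qed.

Lemma closed_map (X : compactum) (Y : topologicalType) (f : X -> Y) (K : set X) :
  hausdorff_space Y -> continuous f -> closed K -> closed (f @` K).
Proof.
move=> hY cf clK; apply: compact_closed => //; apply: continuous_compact.
  exact: continuous_subspaceT.
exact: subclosed_compact clK (compactum_compact X) _.
Qed.

Lemma closed_preimage (X Y : topologicalType) (f : X -> Y) (K : set Y) :
  continuous f -> closed K -> closed (f @^-1` K).
Proof. by move=> /continuous_closedP; apply. Qed.

Lemma open_preimage (X Y : topologicalType) (f : X -> Y) (U : set Y) :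
  continuous f -> open U -> open (f @^-1` U).
Proof. by move=> /continuousP; apply. Qed.

Lemma compactum_closed1 (X : compactum) (x : X) : closed [set x].
Proof.
exact/accessible_closed_set1/hausdorff_accessible/compactum_hausdorff.
Qed.

Lemma set_type_continuous (X Y : topologicalType) (A : set Y)
    (f : X -> set_type A) :
  continuous (fun x => set_val (f x)) -> continuous f.
Proof.
move=> /continuousP cf; apply/continuousP => _ [W oW <-]; exact: cf.
Qed.

Lemma set_val_continuous (Y : topologicalType) (A : set Y) :
  continuous (set_val : set_type A -> Y).
Proof. exact: initial_continuous. Qed.

(** * Quotients realised as images *)

Section Image.
Variables (Z : compactum) (T : topologicalType) (hT : hausdorff_space T).
Variable g : continuousType Z T.

Definition to_range (z : Z) : set_type (range g) :=
  exist _ (g z) (mem_set (imageT g z)).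

Lemma to_range_continuous : continuous to_range.
Proof. by apply: set_type_continuous; exact: cts_fun. Qed.

Lemma to_range_surj : surjective to_range.
Proof.
apply: surjectiveI => -[t tg]; have [z _ gz] := set_mem tg.
by exists z; apply: val_inj.
Qed.

Lemma range_compact : compact [set: set_type (range g)].
Proof.
have -> : [set: set_type (range g)] = to_range @` [set: Z].
  by apply/seteqP; split=> // t _; exact: to_range_surj.
apply: continuous_compact; last exact: compactum_compact.
exact/continuous_subspaceT/to_range_continuous.
Qed.

Lemma range_hausdorff : hausdorff_space (set_type (range g)).
Proof.
move=> x y clxy; apply: val_inj; apply: hT => A B nA nB.
have [z [Az Bz]] := clxy _ _ (set_val_continuous nA) (set_val_continuous nB).
by exists (set_val z).
Qed.

Definition image_compactum : compactum :=
  Compactum range_compact range_hausdorff.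

Definition to_image : continuousType Z image_compactum :=
  mkcts to_range_continuous.

Lemma to_image_surj : surjective to_image.
Proof. exact: to_range_surj. Qed.

Lemma to_image_eq z z' : to_image z = to_image z' <-> g z = g z'.
Proof.
split=> [/(congr1 set_val)//|e].
by apply: val_inj.
Qed.

End Image.

(* A surjection from a compact space onto a Hausdorff space is a quotient map. *)
Lemma factor_ex (Z C D : compactum) (p : continuousType Z C)
    (q : continuousType Z D) :
  surjective p -> (forall z z', p z = p z' -> q z = q z') ->
  exists r : continuousType C D, forall z, r (p z) = q z.
Proof.
move=> ps pq.
have [s sK] := choice (fun c => surjectiveP c ps).
have cr : continuous (fun c => q (s c)).
  apply/continuous_closedP => A clA.
  have -> : (fun c => q (s c)) @^-1` A = p @` (q @^-1` A).
    apply/seteqP; split=> [c Ac|_ [z Az <-] /=]; first by exists (s c).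
    by rewrite (pq _ z).
  apply: (closed_map (@compactum_hausdorff _) (@cts_fun _ _ _)).
  by apply: closed_preimage clA; exact: cts_fun.
by exists (mkcts cr) => z; apply: pq.
Qed.

Definition factor_map (Z C D : compactum) (p : continuousType Z C)
    (q : continuousType Z D) (ps : surjective p)
    (pq : forall z z', p z = p z' -> q z = q z') : continuousType C D :=
  projT1 (cid (factor_ex ps pq)).

Lemma factor_mapE (Z C D : compactum) (p : continuousType Z C)
    (q : continuousType Z D) (ps : surjective p)
    (pq : forall z z', p z = p z' -> q z = q z') z :
  factor_map ps pq (p z) = q z.
Proof. exact: (projT2 (cid (factor_ex ps pq))). Qed.

Section Discrete.
Variables (Z : compactum) (g : continuousType Z nat).

(** A map to [nat] encodes a finite clopen partition of Z; its image is the finite discrete space of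
    blocks. *)
Definition nat_image : compactum := image_compactum discrete_hausdorff g.
Definition to_nat_image : continuousType Z nat_image :=
  to_image discrete_hausdorff g.

Lemma nat_image_open (A : set nat_image) : open A.
Proof.
exists (set_val @` A); first exact: discrete_open.
apply/seteqP; split=> [x [y Ay /val_inj <-]//|x Ax]; by exists x.
Qed.

(** Locally g is constant, so all large n are bounds near each point; the near-covering form of
    compactness makes the bound uniform. *)
Lemma nat_bounded : exists n, forall z, g z < n.
Proof.
have /compact_near_coveringP cZ := compactum_compact Z.
have [|n _ nB] := cZ nat \oo (fun n z => g z < n) _; last first.
  by exists n => z; exact: (nB n (leqnn n) z I).
move=> z _; exists ([set z' | g z' = g z], [set n | g z < n]).
  split; last by exists (g z).+1.
  have cg : continuous g by exact: cts_fun.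
  exact: (cg z [set g z] (discrete_set1 (g z))).
by move=> [z' n] /= [-> ].
Qed.

Lemma nat_image_finite : finite_space nat_image.
Proof.
have [n gn] := nat_bounded.
apply: (@sub_finite_set _ _ (set_val @^-1` `I_n)).
  by move=> x _; have [z _ gz] := set_valP x; rewrite /= /set_val /= -gz; exact: gn.
by apply: finite_preimage (finite_II n) => x y _ _; exact: val_inj.
Qed.
End Discrete.

Lemma nat_image_continuous (Z : compactum) (g : continuousType Z nat)
  (Y : topologicalType) (f : nat_image g -> Y) : continuous f.
Proof. by apply/continuousP => A _; exact: nat_image_open. Qed.

(** Otherwise the sets of points of K that agree with w at i form a filter base, by directedness. A
    cluster point in K then agrees with w at every i, hence equals w. *)
Lemma directed_separation (Z : topologicalType) (I : directed_set)
    (C : I -> compactum) (q : forall i, continuousType Z (C i))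
    (K : set Z) (w : Z) :
  (forall i j, ds_le i j -> forall z z', q j z = q j z' -> q i z = q i z') ->
  (forall z z', (forall i, q i z = q i z') -> z = z') ->
  compact K -> ~ K w -> exists i, ~ (q i @` K) (q i w).
Proof.
move=> qle qinj cK Kw; apply: contrapT => /forallNP nq.
have {nq} qK i : exists2 z, K z & q i z = q i w by exact: contrapT (nq i).
pose B i := K `&` q i @^-1` [set q i w].
have FP : ProperFilter (filter_from [set: I] B).
  apply: filter_from_proper; last first.
    by move=> i _; have [z Kz e] := qK i; exists z.
  apply: filter_from_filter; first by have [i] := ds_inhabited I; exists i.
  move=> i j _ _; have [k [ik jk]] := ds_directed i j.
  by exists k => // z [Kz e]; split; split => //; exact: qle e.
have [|z [Kz]] := cK _ FP.
  by have [i] := ds_inhabited I; exists i => // z [].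
rewrite clusterE => zB; apply: Kw; suff -> : w = z by [].
apply: qinj => i; apply/esym.
have cl : closed (q i @^-1` [set q i w]).
  by apply: closed_preimage (@compactum_closed1 _ _); exact: cts_fun.
by apply: cl; apply: zB; exists i => // z' [].
Qed.

(** Shrink V to a neighbourhood V' of v with closure inside V. The image of that closure is closed;
    without interior it would be nowhere dense, although its preimage contains V'. *)
Lemma skeletal_image (X Y : compactum) (f : continuousType X Y) (V : set X) :
  skeletal_map f -> open V -> V !=set0 ->
  exists W, [/\ open W, W !=set0 & W `<=` f @` V].
Proof.
move=> skf oV [v Vv].
have nV : nbhs v V by exact: open_nbhs_nbhs.
have [V' nV' clV'] := compact_regular (@compactum_hausdorff X)
  (compactum_compact X) filterT nV.
have clf : closed (f @` closure V').
  apply: (closed_map (@compactum_hausdorff _) (@cts_fun _ _ _)).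
  exact: closed_closure.
exists (interior (f @` closure V')); split; first exact: open_interior.
  apply/set0P/eqP => e.
  have /skf : nowhere_dense (f @` closure V').
    by rewrite /nowhere_dense -(closure_id _).1.
  rewrite /nowhere_dense => e'.
  suff : interior (closure (f @^-1` (f @` closure V'))) v by rewrite e'.
  apply: filterS nV' => z V'z; apply: subset_closure; exists z => //.
  exact: subset_closure.
by move=> y /interior_subset [x /clV' Vx <-]; exists x.
Qed.

(** If the closure of the preimage of A had interior, the image of this interior would contain a
    nonempty open W; by continuity that image lies in the closure of A. *)
Lemma skeletal_mapI (X Y : topologicalType) (f : X -> Y) : continuous f ->
  (forall V : set X, open V -> V !=set0 ->
     exists W, [/\ open W, W !=set0 & W `<=` f @` V]) ->
  skeletal_map f.
Proof.
move=> cf fV A nA; apply: contrapT => /eqP/set0P/(fV _ (@open_interior _ _)).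
move=> [W [oW [w Ww] Wf]].
suff : interior (closure A) w by rewrite nA.
apply: filterS (open_nbhs_nbhs (conj oW Ww)) => y /Wf [x Ax <-].
have cl : closed (f @^-1` closure A).
  exact: closed_preimage cf (@closed_closure _ A).
apply: cl; apply: closureS (interior_subset Ax) => z Az.
exact: (@subset_closure _ A (f z)).
Qed.

(** * The Gleason cover *)

(** These correspond to the ultrafilters of the Boolean algebra of regular open sets. Maximality is
    encoded by primeness together with [gleason_dense], which puts every dense open set into u. *)
Record gleason_filter (X : topologicalType) (u : set (set X)) : Prop := {
  gleason_open : forall U, u U -> open U;
  gleason_set0 : ~ u set0;
  gleason_setT : u setT;
  gleason_setI : forall U V, u U -> u V -> u (U `&` V);
  gleason_dense : forall U V, u U -> open V -> U `<=` closure V -> u V;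
  gleason_prime : forall U V, open U -> open V -> u (U `|` V) -> u U \/ u V }.

Record gleason (X : topologicalType) := Gleason {
  gleason_sets :> set X -> Prop;
  gleasonP : gleason_filter gleason_sets }.

Section GleasonTheory.
Variable X : topologicalType.
Implicit Types (u v : gleason X) (U V : set X).

Lemma gleason_compl u U : open U -> ~ u U -> u (~` closure U).
Proof.
move=> oU uU; have oC : open (~` closure U).
  exact/closed_openC/closed_closure.
suff uUC : u (U `|` ~` closure U) by have [] := gleason_prime (gleasonP u) oU oC uUC.
apply: (gleason_dense (gleasonP u) (gleason_setT (gleasonP u))).
  exact: openU.
move=> x _; have [Ux|Ux] := pselect (closure U x).
  by apply: closureS Ux => y Uy; left.
by apply: subset_closure; right.
Qed.

Lemma gleason_disjoint u U V : u U -> u V -> U `&` V !=set0.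
Proof.
move=> uU uV; apply/set0P/eqP => UV0; apply: (gleason_set0 (gleasonP u)).
by rewrite -UV0; exact: (gleason_setI (gleasonP u)).
Qed.

(** This is maximality: if U is in v but not in u, the complement of its closure is in u, hence in
    v, and is disjoint from U. *)
Lemma gleason_sub_eq u v : gleason_sets u `<=` gleason_sets v -> u = v.
Proof.
move=> uv; suff e : gleason_sets u = gleason_sets v.
  move: u v e {uv} => [u Pu] [v Pv] /= uv; rewrite uv in Pu *.
  by congr Gleason; exact: Prop_irrelevance.
apply/seteqP; split=> // U vU; apply: contrapT => uU.
have oU := gleason_open (gleasonP v) vU.
have [x [Ux]] := gleason_disjoint vU (uv _ (gleason_compl oU uU)).
by apply; exact: subset_closure.
Qed.

(* An ultrafilter of arbitrary sets that contains the dense open sets traces a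
   maximal filter of open sets. *)
Lemma gleason_extend (B : set (set X)) :
  (forall U, B U -> open U) -> ~ B set0 -> B setT ->
  (forall U V, B U -> B V -> B (U `&` V)) ->
  exists u, B `<=` gleason_sets u.
Proof.
move=> Bo B0 BT BI.
pose D := [set UE : set X * set X | [/\ B UE.1, open UE.2 & dense UE.2]].
pose b (UE : set X * set X) := UE.1 `&` UE.2.
have dI (E E' : set X) : open E -> dense E -> dense E' -> dense (E `&` E').
  move=> oE dE dE' O O0 oO.
  have [x [[Ox Ex] E'x]] : O `&` E `&` E' !=set0.
    by apply: dE' => //; [exact: dE|exact: openI].
  by exists x.
have dT : dense [set: X] by move=> O [x Ox] _; exists x.
have FP : ProperFilter (filter_from D b).
  apply: filter_from_proper.
    apply: filter_from_filter.
      by exists (setT, setT); split => //=; exact: openT.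
    move=> [U E] [V E'] [/= BU oE dE] [/= BV oE' dE'].
    exists (U `&` V, E `&` E').
      by split => /=; [exact: BI|exact: openI|exact: dI].
    by move=> x /= [[Ux Vx] [Ex E'x]]; split; split.
  move=> [U E] [/= BU oE dE]; apply: dE; last exact: Bo.
  by apply/set0P/eqP => /= U0; rewrite U0 in BU.
have [G [GU FG]] := ultraFilterLemma FP.
have GB U : B U -> G U.
  move=> BU; apply: FG; exists (U, setT); last by move=> x [].
  by split => //=; exact: openT.
have GE E : open E -> dense E -> G E.
  by move=> oE dE; apply: FG; exists (setT, E) => // x [].
suff Pu : gleason_filter [set U | open U /\ G U].
  by exists (Gleason Pu) => U BU; split; [exact: Bo|exact: GB].
split.
- by move=> U [].
- by move=> [_ /(@filter_not_empty _ _ _)].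
- by split; [exact: openT|exact: filterT].
- by move=> U V [oU GU'] [oV GV]; split; [exact: openI|exact: filterI].
- move=> U V [oU GU'] oV UV; split => //.
  have oC : open (~` closure V) by exact/closed_openC/closed_closure.
  (* V together with its exterior is open and dense, so G contains it; on U, which lies in the
     closure of V, only V remains. *)
  have GD : G (V `|` ~` closure V).
    apply: GE; first exact: openU.
    move=> O [x Ox] oO; have [Vx|Vx] := pselect (closure V x).
      have [y [Vy Oy]] := Vx O (open_nbhs_nbhs (conj oO Ox)).
      by exists y; split => //; left.
    by exists x; split => //; right.
  by apply: filterS (filterI GU' GD) => x [/UV Vx [//|/(_ Vx)]].
- move=> U V oU oV [_ GUV].
  have [GU'|GU'] := in_ultra_setVsetC U GU; first by left.
  right; split => //; apply: filterS (filterI GUV GU') => x [[Ux|//] nUx].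
  by case: (nUx Ux).
Qed.

Lemma gleason_setIP u U V : open U -> open V -> u (U `&` V) -> u U /\ u V.
Proof.
by move=> oU oV uUV; split; apply: (gleason_dense (gleasonP u) uUV) => // x [];
   do 2?move=> ?; exact: subset_closure.
Qed.

End GleasonTheory.

HB.instance Definition _ (X : topologicalType) := gen_eqMixin (gleason X).
HB.instance Definition _ (X : topologicalType) := gen_choiceMixin (gleason X).

Definition gleason_basic (X : topologicalType) (U : set X) : set (gleason X) :=
  [set u | u U].

Lemma gleason_basic_cover (X : topologicalType) :
  \bigcup_(U in [set: set X]) gleason_basic U = setT.
Proof.
by apply/seteqP; split=> // u _; exists setT; [|exact: gleason_setT (gleasonP u)].
Qed.

Lemma gleason_basic_join (X : topologicalType) (U V : set X) (u : gleason X) :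
  [set: set X] U -> [set: set X] V -> gleason_basic U u -> gleason_basic V u ->
  exists W, [/\ [set: set X] W, gleason_basic W u &
    gleason_basic W `<=` gleason_basic U `&` gleason_basic V].
Proof.
move=> _ _ uU uV; exists (U `&` V); split=> //.
  exact: (gleason_setI (gleasonP u)).
have oU := gleason_open (gleasonP u) uU.
have oV := gleason_open (gleasonP u) uV.
by move=> v /(gleason_setIP oU oV).
Qed.

HB.instance Definition _ (X : topologicalType) :=
  isBaseTopological.Build (gleason X) (@gleason_basic_cover X)
    (@gleason_basic_join X).

Section GleasonTopology.
Variable X : topologicalType.
Implicit Types (u v : gleason X) (U V : set X).

Lemma gleason_basic_open U : open (gleason_basic U).
Proof. by exists [set U] => //; rewrite bigcup_set1. Qed.

Lemma gleason_open_basic (A : set (gleason X)) u : open A -> A u ->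
  exists U, u U /\ gleason_basic U `<=` A.
Proof.
by move=> [D _ <-] [U DU uU]; exists U; split=> // v vU; exists U.
Qed.

Lemma gleason_compact : compact [set: gleason X].
Proof.
rewrite compact_ultra => G GU _.
(* The limit of the ultrafilter G consists of the open U whose basic set is G-large. *)
suff Pu : gleason_filter [set U | open U /\ G (gleason_basic U)].
  exists (Gleason Pu); split => // A.
  rewrite nbhsE => -[B [oB Bu] BA].
  have [U [[oU GU'] UB]] := gleason_open_basic oB Bu.
  by apply: filterS GU' => v /UB /BA.
split.
- by move=> U [].
- move=> [_ G0]; have [v] := filter_ex G0.
  exact: gleason_set0 (gleasonP v).
- split; first exact: openT.
  by apply: filterS filterT => v _; exact: gleason_setT (gleasonP v).
- move=> U V [oU GU'] [oV GV]; split; first exact: openI.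
  by apply: filterS (filterI GU' GV) => v [vU vV];
     exact: (gleason_setI (gleasonP v)).
- move=> U V [oU GU'] oV UV; split => //.
  by apply: filterS GU' => v vU; exact: (gleason_dense (gleasonP v) vU).
- move=> U V oU oV [_ GUV].
  have [GU'|GU'] := in_ultra_setVsetC (gleason_basic U) GU; first by left.
  right; split => //; apply: filterS (filterI GUV GU') => v [vUV nUv].
  by have [|] := gleason_prime (gleasonP v) oU oV vUV.
Qed.

Lemma gleason_hausdorff : hausdorff_space (gleason X).
Proof.
move=> u v cl; apply: gleason_sub_eq => U uU; apply: contrapT => vU.
have oU := gleason_open (gleasonP u) uU.
have nu : nbhs u (gleason_basic U).
  exact: open_nbhs_nbhs (conj (@gleason_basic_open _) uU).
have nv : nbhs v (gleason_basic (~` closure U)).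
  exact: open_nbhs_nbhs (conj (@gleason_basic_open _) (gleason_compl oU vU)).
have [w [wU wC]] := cl _ _ nu nv.
have [x [Ux]] := gleason_disjoint wU wC.
by apply; exact: subset_closure.
Qed.

Definition gleason_compactum : compactum :=
  Compactum gleason_compact gleason_hausdorff.

End GleasonTopology.

Lemma gleason_separated (X : topologicalType) (u v : gleason X) :
  (forall g : continuousType (gleason X) nat, g u = g v) -> u = v.
Proof.
move=> guv; apply: gleason_sub_eq => U uU; apply: contrapT => vU.
have oU := gleason_open (gleasonP u) uU.
(* The indicator of the basic set of U is continuous: by [gleason_compl] the points outside have the
   basic set of the exterior of U as a neighbourhood. *)
pose g (w : gleason X) : nat := `[< w U >].
have cg : continuous g.
  apply/continuousP => A _.
  rewrite openE => w Aw; have [wU|wU] := pselect (w U).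
    apply: filterS (open_nbhs_nbhs (conj (@gleason_basic_open _ U) wU)).
    by move=> z zU; rewrite /= /g (asboolT zU) -(asboolT wU).
  apply: filterS (open_nbhs_nbhs (conj (@gleason_basic_open _ (~` closure U))
    (gleason_compl oU wU))) => z zU.
  have nzU : ~ z U.
    move=> /gleason_disjoint/(_ zU) [x [Ux]].
    by apply; exact: subset_closure.
  by rewrite /= /g (asboolF nzU) -(asboolF wU).
have : g u = g v := guv (mkcts cg).
by rewrite /g (asboolT uU) (asboolF vU).
Qed.

(** * The projection of the Gleason cover *)

Section GleasonProjection.
Variable X : compactum.
Implicit Types (u v : gleason X).

(** By compactness u has a cluster point x. An open U around x that is missing from u would put its
    exterior into u, away from x. *)
Lemma gleason_point_ex u : exists x, forall U, open U -> U x -> u U.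
Proof.
have FP : ProperFilter (filter_from (gleason_sets u) id).
  apply: filter_from_proper.
    apply: filter_from_filter.
      by exists setT; exact: gleason_setT (gleasonP u).
    by move=> U V uU uV; exists (U `&` V); [exact: (gleason_setI (gleasonP u))|].
  move=> U uU; have [x []] := gleason_disjoint uU uU.
  by exists x.
have [|x [_ xcl]] := compactum_compact X _ FP.
  by exists setT => //; exact: gleason_setT (gleasonP u).
exists x => U oU Ux; apply: contrapT => uU.
have [|y [nUy Uy]] := xcl (~` closure U) U _ (open_nbhs_nbhs (conj oU Ux)).
  by exists (~` closure U) => //; exact: gleason_compl.
by apply: nUy; exact: subset_closure.
Qed.

Definition gleason_point u : X := projT1 (cid (gleason_point_ex u)).

Lemma gleason_pointP u U : open U -> U (gleason_point u) -> u U.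
Proof. exact: (projT2 (cid (gleason_point_ex u))). Qed.

Lemma gleason_point_closure u U : u U -> closure U (gleason_point u).
Proof.
move=> uU; apply: contrapT => nU.
have uC : u (~` closure U).
  by apply: gleason_pointP => //; exact/closed_openC/closed_closure.
have [x [Ux]] := gleason_disjoint uU uC.
by apply; exact: subset_closure.
Qed.

Lemma gleason_point_eq u x : (forall U, open U -> U x -> u U) ->
  gleason_point u = x.
Proof.
move=> ux; apply: (compactum_hausdorff X) => A B.
rewrite !nbhsE => -[U [oU Uu] UA] [V [oV Vx] VB].
have [y [Uy Vy]] := gleason_disjoint (gleason_pointP oU Uu) (ux _ oV Vx).
by exists y; split; [exact: UA|exact: VB].
Qed.

(** The basic set of U projects into the closure of U, so regularity of X suffices. *)
Lemma gleason_point_continuous : continuous gleason_point.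
Proof.
move=> u A nA.
have [V nV VA] := compact_regular (@compactum_hausdorff X)
  (compactum_compact X) filterT nA.
move: nV; rewrite nbhsE => -[U [oU Uu] UV].
apply: filterS (open_nbhs_nbhs (conj (@gleason_basic_open _ U)
  (gleason_pointP oU Uu))) => v vU.
by apply: VA; apply: closureS UV _ _; exact: gleason_point_closure.
Qed.

Definition gleason_proj : continuousType (gleason_compactum X) X :=
  mkcts gleason_point_continuous.

Lemma gleason_proj_surj : surjective gleason_proj.
Proof.
apply: surjectiveI => x.
have [|||U V [oU Ux] [oV Vx]|u ux] :=
    @gleason_extend X [set U | open U /\ U x].
- by move=> U [].
- by case.
- by split=> //; exact: openT.
- by split=> //; exact: openI.
by exists u; apply: gleason_point_eq => U oU Ux; apply: ux.
Qed.

End GleasonProjection.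

(** * Lifting open surjections to Gleason covers *)

Section GleasonMap.
Variables (X Y : compactum) (f : continuousType X Y).
Hypotheses (of_ : open_map f) (fs : surjective f).

Lemma gleason_map_proof (u : gleason X) :
  gleason_filter [set V | open V /\ u (f @^-1` V)].
Proof.
have fo V : open V -> open (f @^-1` V) by apply: open_preimage; exact: cts_fun.
split.
- by move=> V [].
- by move=> [_]; rewrite preimage_set0; exact: gleason_set0 (gleasonP u).
- by split; [exact: openT|exact: gleason_setT (gleasonP u)].
- move=> U V [oU uU] [oV uV]; split; first exact: openI.
  exact: (gleason_setI (gleasonP u)).
- move=> U V [oU uU] oV UV; split => //.
  apply: (gleason_dense (gleasonP u) uU); first exact: fo.
  (* Openness of f places the preimage of the closure of V inside the closure of the preimage of
     V. *)
  move=> x /UV Vx A; rewrite nbhsE => -[O [oO Ox] OA].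
  have nO : nbhs (f x) (f @` O).
    by apply: open_nbhs_nbhs; split; [exact: of_|exists x].
  have [t [Vt [y Oy e]]] := Vx _ nO.
  by exists y; split; [rewrite /preimage /= e|exact: OA].
- move=> U V oU oV [_ uUV].
  have [uU|uV] := gleason_prime (gleasonP u) (fo _ oU) (fo _ oV) uUV.
    by left.
  by right.
Qed.

Definition gleason_map_fun (u : gleason X) : gleason Y :=
  Gleason (gleason_map_proof u).

Lemma gleason_map_continuous : continuous gleason_map_fun.
Proof.
apply/continuousP => A oA; rewrite openE => u Au.
have [V [[oV uV] VA]] := gleason_open_basic oA Au.
apply: filterS (open_nbhs_nbhs (conj (@gleason_basic_open _ (f @^-1` V)) uV)).
by move=> v vV; exact: VA.
Qed.

Definition gleason_map :
    continuousType (gleason_compactum X) (gleason_compactum Y) :=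
  mkcts gleason_map_continuous.

Lemma gleason_map_proj :
  gleason_proj Y \o gleason_map =1 f \o gleason_proj X.
Proof.
move=> u; apply: gleason_point_eq => V oV Vx; split => //.
by apply: gleason_pointP => //; apply: open_preimage oV; exact: cts_fun.
Qed.

Lemma gleason_map_basic (U : set X) : open U ->
  gleason_map @` gleason_basic U = gleason_basic (f @` U).
Proof.
move=> oU; have fo V : open V -> open (f @^-1` V).
  by apply: open_preimage; exact: cts_fun.
apply/seteqP; split=> [_ [u uU <-]|v vfU].
  split; first exact: of_.
  apply: (gleason_dense (gleasonP u) uU); first exact/fo/of_.
  by move=> x Ux; apply: subset_closure; exists x.
(* B is generated by U and the preimages of the members of v; it is proper because v contains the
   image of U. A point extending B lies over v by maximality. *)
pose B := [set W : set X | open W /\ exists2 V, v V & U `&` f @^-1` V `<=` W].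
have [||||u Bu] := @gleason_extend X B.
- by move=> W [].
- move=> [_ [V vV VU]].
  have [t [Vt [x Ux fx]]] := gleason_disjoint vV vfU.
  by apply: (VU x); split; rewrite // /preimage /= fx.
- by split; [exact: openT|exists setT => //; exact: gleason_setT (gleasonP v)].
- move=> W W' [oW [V vV VW]] [oW' [V' vV' VW']]; split; first exact: openI.
  exists (V `&` V'); first exact: (gleason_setI (gleasonP v)).
  by move=> x [Ux [Vx V'x]]; split; [apply: VW|apply: VW'].
exists u.
  apply: Bu; split => //; exists setT; first exact: gleason_setT (gleasonP v).
  by move=> x [].
apply/esym/gleason_sub_eq => V vV.
have oV := gleason_open (gleasonP v) vV.
split => //; apply: Bu; split; first exact: fo.
by exists V => // x [].
Qed.

Lemma gleason_map_open : open_map gleason_map.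
Proof.
move=> A oA; rewrite openE => _ [u Au <-].
have [U [uU UA]] := gleason_open_basic oA Au.
have oU := gleason_open (gleasonP u) uU.
have o : open (gleason_map @` gleason_basic U).
  by rewrite gleason_map_basic //; exact: gleason_basic_open.
apply: (@filterS _ (nbhs (gleason_map u)) _ (gleason_map @` gleason_basic U)).
  by move=> _ [w wU <-]; exists w => //; exact: UA.
by apply: open_nbhs_nbhs; split=> //; exists u.
Qed.

Lemma gleason_map_surj : surjective gleason_map.
Proof.
move=> v _; have : (gleason_map @` gleason_basic setT) v.
  rewrite gleason_map_basic; last exact: openT.
  have -> : f @` setT = setT by apply/seteqP; split=> // y _; exact: fs.
  exact: gleason_setT (gleasonP v).
by move=> [u _ <-]; exists u.
Qed.

End GleasonMap.

(** * Cones and bicommutative pairs of finite partitions *)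

Section Cone.
Variables (I : directed_set) (Z : compactum) (C : I -> compactum).
Variable q : forall i, continuousType Z (C i).
Hypothesis qs : forall i, surjective (q i).
Hypothesis qle : forall i j, ds_le i j ->
  forall z z', q j z = q j z' -> q i z = q i z'.

Definition cone_map (i j : I) (le_ij : ds_le i j) : continuousType (C j) (C i) :=
  factor_map (@qs j) (qle le_ij).

Lemma cone_mapE (i j : I) (le_ij : ds_le i j) z :
  cone_map le_ij (q j z) = q i z.
Proof. exact: factor_mapE. Qed.

Lemma cone_map_id (i : I) (le_ii : ds_le i i) : cone_map le_ii =1 id.
Proof. by move=> c; have [z <-] := surjectiveP c (@qs i); rewrite cone_mapE. Qed.

Lemma cone_map_comp (i j k : I)
    (le_ij : ds_le i j) (le_jk : ds_le j k) (le_ik : ds_le i k) :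
  cone_map le_ij \o cone_map le_jk =1 cone_map le_ik.
Proof.
by move=> c; have [z <-] := surjectiveP c (@qs k); rewrite /= !cone_mapE.
Qed.

Definition cone_spectrum : inverse_spectrum I :=
  InverseSpectrum cone_map_id cone_map_comp.

Lemma cone_threads z : threads cone_spectrum (fun i => q i z).
Proof. by move=> i j le_ij; exact: cone_mapE. Qed.

Definition to_limit_fun z : limit cone_spectrum :=
  exist _ (fun i => q i z) (mem_set (cone_threads z)).

Lemma to_limit_continuous : continuous to_limit_fun.
Proof.
apply: set_type_continuous => z; apply/cvg_sup => i A [_ [[W oW <-] Wz WA]].
apply: filterS (open_nbhs_nbhs (conj (open_preimage (cts_fun (s := q i)) oW) Wz)).
by move=> z' Wz'; exact: WA.
Qed.

Definition to_limit : continuousType Z (limit cone_spectrum) :=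
  mkcts to_limit_continuous.

(* The cone only has to embed Z into the limit: a monomorphic functor keeps
   this embedding injective. *)
Lemma fmap_cone_separates (F : comp_functor) (z z' : F Z) :
  monomorphic F -> continuous_functor F ->
  (forall x y, (forall i, q i x = q i y) -> x = y) ->
  (forall i, fmap F (q i) z = fmap F (q i) z') -> z = z'.
Proof.
move=> Fm Fc qinj zz'.
have einj : injective to_limit.
  move=> x y exy; apply: qinj => i.
  exact: (congr1 (fun t => limit_proj cone_spectrum i t) exy).
apply: (Fm _ _ _ einj).
have [_ [g [/can_inj cinj _ _]]] := Fc I cone_spectrum.
apply: cinj; apply: val_inj; apply: functional_extensionality_dep => i /=.
have e : (limit_proj cone_spectrum i \o to_limit : continuousType Z (C i)) = q i.
  by apply/continuousEP.
transitivity (fmap F (q i) z); first by rewrite -e fmap_comp.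
by rewrite zz' -e fmap_comp.
Qed.

End Cone.

(** * Finite bicommutative approximations of an open map *)

Section BicommutativePairs.
Variables (X Y : compactum) (t : continuousType X Y).

(** Finite partitions of X and Y between whose blocks t induces a map. [pair_lift] is
    bicommutativity of the square formed by t, the two quotient maps and this induced map. *)
Record bicom_pair := BicomPair {
  pair_src : continuousType X nat;
  pair_tgt : continuousType Y nat;
  pair_map : forall x x', pair_src x = pair_src x' ->
    pair_tgt (t x) = pair_tgt (t x');
  pair_lift : forall x y, pair_tgt y = pair_tgt (t x) ->
    exists2 x', pair_src x' = pair_src x & t x' = y }.

Definition bicom_le (i j : bicom_pair) :=
  (forall x x', pair_src j x = pair_src j x' -> pair_src i x = pair_src i x') /\
  (forall y y', pair_tgt j y = pair_tgt j y' -> pair_tgt i y = pair_tgt i y').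

Lemma nat_locally_constant (Z : topologicalType) (g : Z -> nat) :
  continuous g <-> forall z, nbhs z [set z' | g z' = g z].
Proof.
split=> [cg z|gz]; first exact: (cg z [set g z] (discrete_set1 (g z))).
by move=> z A nA; apply: filterS (gz z) => z' /= ->; exact: nbhs_singleton.
Qed.

Hypothesis ot : open_map t.

(* Recording, besides h, which images of the fibres of g contain a point makes
   the square bicommutative. *)
Lemma bicom_pair_refine (g : continuousType X nat) (h : continuousType Y nat) :
  exists k : bicom_pair,
    (forall x x', pair_src k x = pair_src k x' -> g x = g x') /\
    (forall y y', pair_tgt k y = pair_tgt k y' -> h y = h y').
Proof.
have [N gN] := nat_bounded g.
pose im n := [set y | exists2 x, g x = n & t x = y].
have gn n : closed (g @^-1` [set n]) /\ open (g @^-1` [set n]).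
  split; last by apply: open_preimage (discrete_open _); exact: cts_fun.
  by apply: closed_preimage (discrete_closed _); exact: cts_fun.
have imE n : im n = t @` (g @^-1` [set n]) by [].
(* The blocks of g are clopen and t is both open and closed, so each [im n] is clopen. *)
have im_loc n y : nbhs y [set y' | `[< im n y' >] = `[< im n y >]].
  have [iy|iy] := pselect (im n y).
    have : nbhs y (im n).
      by rewrite imE; apply: open_nbhs_nbhs; split=> //; apply: ot; case: (gn n).
    by apply: filterS => y' iy' /=; rewrite !asboolT.
  have : nbhs y (~` im n).
    apply: open_nbhs_nbhs; split=> //; apply: closed_openC; rewrite imE.
    by apply: (closed_map (@compactum_hausdorff _) (@cts_fun _ _ _)); case: (gn n).
  by apply: filterS => y' iy' /=; rewrite !asboolF.
pose code y := [seq n <- iota 0 N | `[< im n y >]].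
have code_loc y : nbhs y [set y' | code y' = code y].
  rewrite /code; elim: (iota 0 N) => [|n s IH] /=.
    by apply: filterS filterT => y'.
  by apply: filterS (filterI (im_loc n y) IH) => y' /= [-> ->].
have codeP y x : code y = code (t x) -> im (g x) y.
  move=> e; have : g x \in code (t x).
    rewrite mem_filter mem_iota /= add0n gN andbT; apply/asboolP.
    by exists x.
  by rewrite -e mem_filter => /andP[/asboolP].
pose r y : nat := pickle (h y, code y).
have rE y y' : r y = r y' -> h y = h y' /\ code y = code y'.
  by move=> /(pcan_inj pickleK) [].
have cr : continuous r.
  apply/nat_locally_constant => y.
  have /nat_locally_constant/(_ y) hy : continuous h by exact: cts_fun.
  by apply: filterS (filterI hy (code_loc y)) => y' /= []; rewrite /r => -> ->.
(* Recording [r (t x)] makes [pair_map] immediate and survives lifting: a lift x' of y satisfies r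
   (t x') = r y = r (t x). *)
pose q x : nat := pickle (g x, r (t x)).
have qE x x' : q x = q x' -> g x = g x' /\ r (t x) = r (t x').
  by move=> /(pcan_inj pickleK) [].
have cq : continuous q.
  apply/nat_locally_constant => x.
  have /nat_locally_constant/(_ x) gx : continuous g by exact: cts_fun.
  have /nat_locally_constant/(_ x) rx : continuous (r \o t).
    by move=> z; apply: continuous_comp; [exact: cts_fun|exact: cr].
  by apply: filterS (filterI gx rx) => x' /= []; rewrite /q => -> ->.
unshelve eexists.
  apply: (@BicomPair (mkcts cq) (mkcts cr)).
    by move=> x x' /qE [].
  move=> x y e; have [x' gx' tx'] := codeP _ _ (rE _ _ e).2.
  exists x' => //; have e' : r y = r (t x) by [].
  by rewrite -[LHS]/(q x') -[RHS]/(q x) /q gx' tx' e'.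
by split=> [x x' /qE []|y y' /rE []].
Qed.

Lemma bicom_inhabited : inhabited bicom_pair.
Proof.
have c0 (Z : topologicalType) : continuous (fun _ : Z => 0%N).
  by move=> ?; exact: cvg_cst.
by have [k _] := bicom_pair_refine (mkcts (@c0 X)) (mkcts (@c0 Y)).
Qed.

Lemma bicom_directed (i j : bicom_pair) :
  exists k, bicom_le i k /\ bicom_le j k.
Proof.
have pc (Z : compactum) (g h : continuousType Z nat) :
    exists gh : continuousType Z nat,
      forall z z', gh z = gh z' -> g z = g z' /\ h z = h z'.
  have cp : continuous (fun z => pickle (g z, h z) : nat).
    apply/nat_locally_constant => z.
    have /nat_locally_constant/(_ z) gz : continuous g by exact: cts_fun.
    have /nat_locally_constant/(_ z) hz : continuous h by exact: cts_fun.
    by apply: filterS (filterI gz hz) => z' /= [-> ->].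
  by exists (mkcts cp) => z z' /(pcan_inj pickleK) [].
have [g gE] := pc _ (pair_src i) (pair_src j).
have [h hE] := pc _ (pair_tgt i) (pair_tgt j).
have [k [kg kh]] := bicom_pair_refine g h.
by exists k; split; split=> [x x' /kg/gE[]|y y' /kh/hE[]].
Qed.

Definition bicom_directed_set : directed_set.
Proof.
apply: (@DirectedSet bicom_pair bicom_le bicom_inhabited _ _ bicom_directed) => //.
by move=> i j k [ij1 ij2] [jk1 jk2]; split=> [x x' /jk1/ij1|y y' /jk2/ij2].
Defined.

End BicommutativePairs.

(** * Images of open sets under the functor *)

Lemma fmap_factor (F : comp_functor) (A B C : compactum)
    (g : continuousType B C) (f : continuousType A B) (h : continuousType A C)
    (a : F A) :
  (forall x, g (f x) = h x) -> fmap F g (fmap F f a) = fmap F h a.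
Proof.
move=> gfh; have <- : (g \o f : continuousType A C) = h by exact/continuousEP.
by rewrite fmap_comp.
Qed.

Lemma to_nat_image_surj (Z : compactum) (g : continuousType Z nat) :
  surjective (to_nat_image g).
Proof. exact: to_image_surj. Qed.

Lemma to_nat_image_eq (Z : compactum) (g : continuousType Z nat) z z' :
  to_nat_image g z = to_nat_image g z' <-> g z = g z'.
Proof. exact: to_image_eq. Qed.

(** * Lifting open sets along an open surjection *)

Section Lift.
Variables (X Y : compactum) (t : continuousType X Y).
Hypotheses (ot : open_map t) (ts : surjective t).
Hypothesis sepX : forall x x' : X,
  (forall g : continuousType X nat, g x = g x') -> x = x'.
Hypothesis sepY : forall y y' : Y,
  (forall g : continuousType Y nat, g y = g y') -> y = y'.

Let I := bicom_directed_set ot.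
Let CX (i : I) : compactum := nat_image (pair_src i).
Let CY (i : I) : compactum := nat_image (pair_tgt i).
Let qX (i : I) : continuousType X (CX i) := to_nat_image (pair_src i).
Let qY (i : I) : continuousType Y (CY i) := to_nat_image (pair_tgt i).

Let qXs (i : I) : surjective (qX i). Proof. exact: to_nat_image_surj. Qed.
Let qYs (i : I) : surjective (qY i). Proof. exact: to_nat_image_surj. Qed.

Let qXle (i j : I) : ds_le i j ->
  forall z z', qX j z = qX j z' -> qX i z = qX i z'.
Proof. by move=> [ij _] z z' /to_nat_image_eq/ij/to_nat_image_eq. Qed.

Let qYle (i j : I) : ds_le i j ->
  forall z z', qY j z = qY j z' -> qY i z = qY i z'.
Proof. by move=> [_ ij] z z' /to_nat_image_eq/ij/to_nat_image_eq. Qed.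

Let cst0 (Z : topologicalType) : continuous (fun _ : Z => 0%N).
Proof. by move=> ?; exact: cvg_cst. Qed.

Let qX_inj x x' : (forall i, qX i x = qX i x') -> x = x'.
Proof.
move=> xx'; apply: sepX => g.
have [k [kg _]] := bicom_pair_refine ot g (mkcts (@cst0 Y)).
by apply: kg; apply/to_nat_image_eq; exact: (xx' k).
Qed.

Let qY_inj y y' : (forall i, qY i y = qY i y') -> y = y'.
Proof.
move=> yy'; apply: sepY => g.
have [k [_ kg]] := bicom_pair_refine ot (mkcts (@cst0 X)) g.
by apply: kg; apply/to_nat_image_eq; exact: (yy' k).
Qed.

Let level_proof (i : I) x x' : qX i x = qX i x' -> (qY i \o t) x = (qY i \o t) x'.
Proof. by move=> /to_nat_image_eq/pair_map/to_nat_image_eq. Qed.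

Let level (i : I) : continuousType (CX i) (CY i) :=
  factor_map (@qXs i) (@level_proof i).

Let levelE (i : I) x : level i (qX i x) = qY i (t x).
Proof. exact: factor_mapE. Qed.

Let level_surj (i : I) : surjective (level i).
Proof.
apply: surjectiveI => c; have [y <-] := surjectiveP c (@qYs i).
by have [x <-] := surjectiveP y ts; exists (qX i x).
Qed.

Let projX (i j : I) (ij : ds_le i j) : continuousType (CX j) (CX i) :=
  cone_map qXs qXle ij.
Let projY (i j : I) (ij : ds_le i j) : continuousType (CY j) (CY i) :=
  cone_map qYs qYle ij.

Let projXE i j (ij : ds_le i j) x : projX ij (qX j x) = qX i x.
Proof. exact: cone_mapE. Qed.
Let projYE i j (ij : ds_le i j) y : projY ij (qY j y) = qY i y.
Proof. exact: cone_mapE. Qed.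

Let projX_surj i j (ij : ds_le i j) : surjective (projX ij).
Proof.
apply: surjectiveI => c; have [x <-] := surjectiveP c (@qXs i).
by exists (qX j x).
Qed.
Let projY_surj i j (ij : ds_le i j) : surjective (projY ij).
Proof.
apply: surjectiveI => c; have [y <-] := surjectiveP c (@qYs i).
by exists (qY j y).
Qed.

(** The lifting property at the coarse index i gives an actual point x' over y; its block at level j
    is the required one. *)
Let level_bicommutative i j (ij : ds_le i j) :
  bicommutative (level j) (projX ij) (projY ij) (level i).
Proof.
split=> [c|c].
  have [x <-] := surjectiveP c (@qXs j).
  by rewrite /= levelE projYE projXE levelE.
have [x <-] := surjectiveP c (@qXs i); rewrite levelE.
apply/seteqP; split=> [_ [d + <-]|d].
  have [x' <-] := surjectiveP d (@qXs j).
  by rewrite /= projXE levelE projYE -levelE => ->; rewrite levelE.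
have [y <-] := surjectiveP d (@qYs j).
rewrite /= projYE => /to_nat_image_eq/pair_lift[x' /to_nat_image_eq xx' tx'].
by exists (qX j x'); [rewrite /= projXE|rewrite levelE tx'].
Qed.

Lemma fmap_open_lift (F : comp_functor) (U : set (F X)) :
  mecw1 F -> finitely_bicommutative F -> finitely_skeletal F ->
  open U -> U !=set0 ->
  exists (h : continuousType Y nat) (W : set (F (nat_image h))),
    [/\ open W, W !=set0 &
        fmap F (to_nat_image h) @^-1` W `<=` fmap F t @` U].
Proof.
move=> [Fm Fe Fc _ _] Fb Fs oU [u Uu].
have FqXle i j : ds_le i j -> forall z z', fmap F (qX j) z = fmap F (qX j) z' ->
    fmap F (qX i) z = fmap F (qX i) z'.
  move=> ij z z' e; rewrite -!(fmap_factor _ (projXE ij)).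
  by rewrite e.
have FqYle i j : ds_le i j -> forall z z', fmap F (qY j) z = fmap F (qY j) z' ->
    fmap F (qY i) z = fmap F (qY i) z'.
  move=> ij z z' e; rewrite -!(fmap_factor _ (projYE ij)).
  by rewrite e.
have cU : compact (~` U).
  exact: subclosed_compact (open_closedC oU) (compactum_compact (F X)) _.
have [i uU] : exists i, ~ (fmap F (qX i) @` (~` U)) (fmap F (qX i) u).
  apply: (directed_separation FqXle) cU _; last by apply.
  by move=> z z'; exact: (fmap_cone_separates qXs qXle Fm Fc qX_inj).
(* V consists of the points of F (CX i) whose whole fibre in F X lies in U; the choice of i puts the
   image of u into V. *)
pose V := ~` (fmap F (qX i) @` (~` U)).
have oV : open V.
  apply/closed_openC/(closed_map (@compactum_hausdorff _) (@cts_fun _ _ _)).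
  exact: open_closedC.
have sk : skeletal_map (fmap F (level i)).
  apply: Fs; [exact: nat_image_finite|exact: nat_image_finite| |exact: level_surj].
  by move=> A _; exact: nat_image_open.
have [|W [oW W0 WV]] := skeletal_image sk oV; first by exists (fmap F (qX i) u).
exists (pair_tgt i), W; split => // w /WV[a Va aw].
(* Since a is in V, its whole fibre lies in U, so it suffices that w is the image of a point of this
   fibre. The set L of such images is compact, so failure would show at a finite level j. *)
pose L := fmap F t @` (fmap F (qX i) @^-1` [set a]).
suff [c ca <-] : L w.
  exists c => //; apply: contrapT => Uc; apply: Va.
  by rewrite -ca; exists c.
have cL : compact L.
  apply: subclosed_compact (compactum_compact (F Y)) _ => //.
  apply: (closed_map (@compactum_hausdorff _) (@cts_fun _ _ _)).
  apply: closed_preimage (@compactum_closed1 _ _); exact: cts_fun.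
apply: contrapT => Lw.
have [j jw] : exists j, ~ (fmap F (qY j) @` L) (fmap F (qY j) w).
  apply: (directed_separation FqYle) cL Lw.
  by move=> z z'; exact: (fmap_cone_separates qYs qYle Fm Fc qY_inj).
(* At a common refinement k, bicommutativity under F gives a point c over both a and the image of w.
   Lifting c to F X yields a point of L that agrees with w at level k, hence at level j. *)
have [k [ik jk]] := ds_directed i j.
have [_ /(_ a) bi] := Fb _ _ _ _ _ _ _ _ (nat_image_finite _)
  (nat_image_finite _) (nat_image_finite _) (nat_image_finite _)
  (@level_surj i) (@level_surj k) (projX_surj ik) (projY_surj ik)
  (level_bicommutative ik).
have : (fmap F (projY ik) @^-1` [set fmap F (level i) a]) (fmap F (qY k) w).
  by rewrite /= (fmap_factor _ (projYE ik)).
rewrite -bi => -[c ca cw].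
have [c' c'E] := surjectiveP c (Fe _ _ _ (@qXs k)).
apply: jw; exists (fmap F t c').
  by exists c' => //; rewrite /= -(fmap_factor _ (projXE ik)) c'E.
apply: FqYle jk _ _ _; rewrite -cw -c'E.
by rewrite (fmap_factor (h := qY k \o t) _ (levelE k)) fmap_comp.
Qed.

End Lift.

(** * Singleton fibres under the functor *)

Lemma pair_hausdorff (A B : topologicalType) :
  hausdorff_space A -> hausdorff_space B -> hausdorff_space (A * B)%type.
Proof.
move=> hA hB [a b] [a' b'] cl; congr pair.
  apply: hA => U V nU nV.
  have [[x y] [Ux Vx]] := cl (fst @^-1` U) (fst @^-1` V)
    (cvg_fst nU) (cvg_fst nV).
  by exists x.
apply: hB => U V nU nV.
have [[x y] [Ux Vx]] := cl (snd @^-1` U) (snd @^-1` V)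
  (cvg_snd nU) (cvg_snd nV).
by exists y.
Qed.

(* Gluing the fibres of p inside each fibre of h gives a map onto Y with one
   singleton fibre for each value of h. Preservation of 1-preimages turns these
   into singleton fibres under F. *)
Lemma fmap_irreducible_open (F : comp_functor) (Z Y : compactum)
    (p : continuousType Z Y) (h : continuousType Z nat)
    (W : set (F (nat_image h))) :
  epimorphic F -> preserves_finite_1preimages F -> surjective p ->
  (forall z, exists y, forall z', p z' = y -> h z' = h z) ->
  open W -> W !=set0 ->
  exists O, [/\ open O, O !=set0 &
    O `<=` fmap F p @` (fmap F (to_nat_image h) @^-1` W)].
Proof.
move=> Fe F1 ps hy oW [w0 Ww0].
have cg : continuous (fun z => (h z, p z)).
  have ch : continuous h by exact: cts_fun.
  have cp : continuous p by exact: cts_fun.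
  by move=> z; exact: cvg_pair (ch z) (cp z).
pose hD := pair_hausdorff (@discrete_hausdorff nat) (@compactum_hausdorff Y).
pose D := image_compactum hD (mkcts cg).
pose r : continuousType Z D := to_image hD (mkcts cg).
have rs : surjective r by exact: to_image_surj.
have rE z z' : r z = r z' <-> (h z, p z) = (h z', p z') by exact: to_image_eq.
have rh z z' : r z = r z' -> to_nat_image h z = to_nat_image h z'.
  by move=> /rE[hz _]; apply/to_nat_image_eq.
have rp z z' : r z = r z' -> p z = p z' by move=> /rE[].
pose qh := factor_map rs rh; pose qp := factor_map rs rp.
have qhE z : qh (r z) = to_nat_image h z by exact: factor_mapE.
have qpE z : qp (r z) = p z by exact: factor_mapE.
(* Each block of h contains a point whose whole p-fibre stays in the block. In D such a fibre
   collapses to a single point. *)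
have sel (n : nat_image h) :
    exists z, to_nat_image h z = n /\ forall z', p z' = p z -> h z' = h z.
  have [z <-] := surjectiveP n (@to_nat_image_surj _ h).
  have [y yz] := hy z; have [z' z'y] := surjectiveP y ps.
  have hz' := yz _ z'y.
  exists z'; split; first by apply/to_nat_image_eq.
  by move=> z''; rewrite z'y hz' => /yz.
have [sel_ selP] := choice sel.
pose s : continuousType (nat_image h) D :=
  mkcts (@nat_image_continuous _ _ _ (fun n => r (sel_ n))).
have sE n : s n = r (sel_ n) by [].
have qhs n : qh (s n) = n by rewrite sE qhE; exact: (selP n).1.
pose f := (qp \o s : continuousType (nat_image h) Y).
have fE n : f n = p (sel_ n) by rewrite /f /= sE qpE.
have finj : injective f.
  move=> n m e; have {}e : p (sel_ n) = p (sel_ m) by rewrite -!fE.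
  rewrite -(selP n).1 -(selP m).1.
  by apply/to_nat_image_eq; exact: (selP m).2.
have sinj : injective s by exact: can_inj qhs.
(* With the identity on one side, bicommutativity says exactly that the fibre of [qp] over f n is
   the singleton of s n. *)
have bi : bicommutative s (idfun : continuousType (nat_image h) _) qp f.
  split=> // n; apply/seteqP; split=> [_ [m /= -> <-]//|d].
  have [z <-] := surjectiveP d rs.
  move=> e; have {}e : p z = p (sel_ n) by rewrite -qpE -fE.
  exists n => //; rewrite sE; apply/rE.
  by rewrite e ((selP n).2 _ e).
have idb : bijective (@idfun (nat_image h)) by exists idfun.
have [_ /(_ w0) bF] := F1 _ _ _ _ _ _ _ _ (@nat_image_finite _ h) finj sinj idb bi.
(* The witness is the set of points whose whole fibre under F qp lies over W, open because F qp is a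
   closed map. It contains F f w0: the only point above this is F s w0, which F qh sends to w0. *)
exists (~` (fmap F qp @` (~` (fmap F qh @^-1` W)))); split.
- apply/closed_openC/(closed_map (@compactum_hausdorff _) (@cts_fun _ _ _)).
  by apply/open_closedC/open_preimage => //; exact: cts_fun.
- exists (fmap F f w0) => -[d Wd dw]; apply: Wd.
  have : (fmap F qp @^-1` [set fmap F f w0]) d by [].
  rewrite -bF => -[a /=]; rewrite fmap_id => -> <-.
  rewrite (fmap_factor (h := idfun) _ qhs).
  by rewrite fmap_id.
- move=> y yO; have [z zy] := surjectiveP y (Fe _ _ _ ps).
  exists z => //; apply: contrapT => Wz; apply: yO.
  exists (fmap F r z); last by rewrite (fmap_factor _ qpE).
  by rewrite /= (fmap_factor _ qhE).
Qed.

(** The clopen block of v contains the basic set of some nonempty open U of Y; every point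
    projecting into U has U as a member, so any y in U works. *)
Lemma gleason_proj_irreducible (Y : compactum)
    (h : continuousType (gleason_compactum Y) nat) (v : gleason_compactum Y) :
  exists y, forall v', gleason_proj Y v' = y -> h v' = h v.
Proof.
have oA : open (h @^-1` [set h v]).
  by apply: open_preimage (discrete_open _); exact: cts_fun.
have [U [vU UA]] := gleason_open_basic (u := v) oA erefl.
have [y [Uy _]] := gleason_disjoint vU vU.
exists y => v' v'y; apply: UA; rewrite -v'y in Uy.
exact: (gleason_pointP (gleason_open (gleasonP v) vU) Uy).
Qed.

Theorem theorem1p3 (F : comp_functor) :
  mecw1 F -> finitely_bicommutative F -> finitely_skeletal F -> skeletal F.
Proof.
move=> F1 Fb Fs X Y f fo fs; have [Fm Fe Fc _ F1p] := F1.
apply: skeletal_mapI; first exact: cts_fun.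
move=> V oV [v Vv].
pose pX := gleason_proj X; pose pY := gleason_proj Y.
have oU : open (fmap F pX @^-1` V) by apply: open_preimage oV; exact: cts_fun.
have U0 : fmap F pX @^-1` V !=set0.
  have [u uv] := surjectiveP v (Fe _ _ _ (@gleason_proj_surj X)).
  by exists u; rewrite /= uv.
have [h [W [oW W0 Wt]]] := fmap_open_lift (gleason_map_open fo)
  (gleason_map_surj fo fs) (@gleason_separated X) (@gleason_separated Y)
  F1 Fb Fs oU U0.
have [O [oO O0 OW]] := fmap_irreducible_open Fe F1p (@gleason_proj_surj Y)
  (@gleason_proj_irreducible Y h) oW W0.
(* A point y of O is the projection of some w over W, and w is the image of some u over V. The
   projection square then gives y as the image of F pX u under F f. *)
exists O; split => // y /OW[w /Wt[u Vu <-] <-].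
exists (fmap F pX u) => //.
by rewrite (fmap_factor (h := f \o pX) _ (gleason_map_proj fo)) fmap_comp.
Qed.
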